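(* Let $X$ be an infinite-dimensional Banach space over $F\in\{\mathbb R,\mathbb C\}$ and let $T:X\to X$ be a bounded linear operator. (i) If $T$ is an isometry, then $T$ is not supercyclic. (ii) If $T$ is power bounded (i.e. $\sup_{n\ge 0}\|T^n\|<\infty$) and supercyclic, then $\lim_{n\to\infty}T^n x= 0$ for every $x\in X$.
   Context: A bounded linear operator $T:X\to X$ on a Banach space over $F$ is called supercyclic if there exists a vector $k\in X$ such that the set $\{\lambda T^n k : \lambda\in F,\ n\ge 0\}$ is dense in $X$. *)

(* Defs.v *)
From HB Require Import structures.
From mathcomp Require Import all_boot all_order all_algebra.
From mathcomp Require Import all_classical all_reals all_analysis.
From mathcomp Require Import complex.

Set Implicit Arguments.
Unset Strict Implicit.
Unset Printing Implicit Defensive.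

Import Order.TTheory GRing.Theory Num.Theory numFieldNormedType.Exports.

Local Open Scope classical_set_scope.
Local Open Scope ring_scope.

Definition finite_dimensional (K : numFieldType) (X : lmodType K) : Prop :=
  exists (n : nat) (e : 'I_n -> X),
    forall x : X, exists c : 'I_n -> K, x = \sum_(i < n) c i *: e i.

Definition supercyclic (K : numFieldType) (X : normedModType K)
    (T : X -> X) : Prop :=
  exists k : X, dense [set y : X | exists (l : K) (n : nat), y = l *: iter n T k].

Definition linear_isometry (K : numFieldType) (X : normedModType K)
    (T : {linear X -> X}) : Prop :=
  forall x : X, `|T x| = `|x|.

(* In MathComp the norm of a normed K-module takes its values in K itself, also
   for K = R[i] (where it is a nonnegative real element of R[i]). The parameter
   [re : K -> R] reads these values as reals, so that suprema can be taken in
   \bar R: it is [idfun] for K = R and [complex.Re] for K = R[i]. *)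
Definition opnorm (R : realType) (K : numFieldType) (re : K -> R)
    (X : normedModType K) (S : X -> X) : \bar R :=
  ereal_sup [set (re `|S x|)%:E | x in [set x : X | `|x| <= 1]].

Definition bounded_operator (R : realType) (K : numFieldType) (re : K -> R)
    (X : normedModType K) (T : {linear X -> X}) : Prop :=
  (opnorm re T < +oo)%E.

Definition power_bounded (R : realType) (K : numFieldType) (re : K -> R)
    (X : normedModType K) (T : {linear X -> X}) : Prop :=
  (ereal_sup [set opnorm re (iter n T) | n in [set: nat]] < +oo)%E.

(* Main.v *)
(** If T is power bounded, N x := limsup |T^n x| is a continuous seminorm with
    N (T x) = N x. Let k be a supercyclic vector. For a real polynomial p, the
    functions N (p(T) x) * N k and N (p(T) k) * N x of x agree on the multiples
    of the orbit of k, hence everywhere. So if N k <> 0, then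
    p |-> N (p(T) k) / N k is a multiplicative seminorm on R[X], and by
    Ostrowski's theorem it vanishes at some quadratic q. Then T^n q(T) k tends
    to 0. If q(T) k <> 0, only finitely many of the lines spanned by the T^n k
    meet a small ball around k; if q(T) k = 0, the orbit of k lies in the span
    of k and T k. In both cases X is finite-dimensional. Hence N = 0, which is
    the second part, and which no isometry of a nonzero space satisfies. *)

Require Import Defs.
From HB Require Import structures.
From mathcomp Require Import all_boot all_order all_algebra.
From mathcomp Require Import all_classical all_reals all_analysis.
From mathcomp Require Import complex.
From mathcomp Require Import ring lra.

Set Implicit Arguments.
Unset Strict Implicit.
Unset Printing Implicit Defensive.

Import Order.TTheory GRing.Theory Num.Theory numFieldNormedType.Exports.

Local Open Scope classical_set_scope.
Local Open Scope ring_scope.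

(** * Ostrowski's theorem for multiplicative seminorms on real polynomials *)

Section MultiplicativeSeminorm.
Variable R : realType.
Implicit Types p q : {poly R}.

(** The signs make s the sum and t the product of the two roots. *)
Definition quad (s t : R) : {poly R} := 'X^2 - s *: 'X + t%:P.

Lemma quad_normal (s t : R) :
  map_poly (real_complex R) (quad s t)
  = 'X^2 - s%:C%C *: 'X + (t%:C%C)%:P.
Proof.
by rewrite /quad !(rmorphD, rmorphN) /= map_polyXn map_polyZ map_polyX map_polyC.
Qed.

(* The condition s^2 <= 4t says that quad s t = (X - z)(X - conj z) for some
   complex z; p^2 is the product of these over the complex roots z of p. *)
Lemma sqr_monic_quads p : p \is monic ->
  exists r : seq (R * R),
    [/\ {in r, forall x, x.1 ^+ 2 <= 4 * x.2}, size r = (size p).-1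
      & p ^+ 2 = \prod_(x <- r) quad x.1 x.2].
Proof.
move=> p_monic; set pC := map_poly (real_complex R) p.
have [r0] := closed_field_poly_normal pC.
have -> : lead_coef pC = 1 by rewrite lead_coef_map (monicP p_monic) rmorph1.
rewrite scale1r => pCE.
(* The coefficients of p are real, so conjugating the roots gives a second factorisation.
   Multiplying the two pairs each root z with its conjugate. *)
have pCJ : pC = \prod_(z <- r0) ('X - (z^*%C)%:P).
  have -> : pC = map_poly (@conjc R) pC.
    by rewrite -map_poly_comp; apply: eq_map_poly => x /=; rewrite oppr0.
  rewrite {1}pCE rmorph_prod; apply: eq_bigr => z _ /=.
  by rewrite rmorphB /= map_polyX map_polyC.
exists [seq (2 * complex.Re z, complex.Re z ^+ 2 + complex.Im z ^+ 2) | z <- r0].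
split.
- move=> _ /mapP[z _ ->] /=; have := sqr_ge0 (complex.Im z); nra.
- have : size pC = (size r0).+1 by rewrite pCE size_prod_XsubC.
  by rewrite size_map_poly size_map => ->.
apply: (map_poly_inj (real_complex R)).
rewrite rmorphXn /= -/pC expr2 {1}pCE pCJ -big_split /= rmorph_prod big_map.
apply: eq_bigr => z _; rewrite [RHS]quad_normal /=.
have -> : (2 * complex.Re z)%:C%C = z + z^*%C by rewrite addcJ rmorphM rmorph_nat.
have -> : (complex.Re z ^+ 2 + complex.Im z ^+ 2)%:C%C = z * z^*%C.
  by rewrite add_Re2_Im2 sqr_normc.
rewrite rmorphM /= -mul_polyC rmorphD /=; ring.
Qed.

Variable nu : {poly R} -> R.
Hypothesis nuM : forall p q, nu (p * q) = nu p * nu q.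
Hypothesis nuD : forall p q, nu (p + q) <= nu p + nu q.
Hypothesis nuC : forall c : R, nu c%:P = `|c|.

Lemma nu0 : nu 0 = 0. Proof. by rewrite -polyC0 nuC normr0. Qed.

Lemma nu1 : nu 1 = 1. Proof. by rewrite -polyC1 nuC normr1. Qed.

Lemma nuN p : nu (- p) = nu p.
Proof. by rewrite -mulN1r nuM -polyC1 -polyCN nuC normrN normr1 mul1r. Qed.

Lemma nu_ge0 p : 0 <= nu p.
Proof.
have : nu 0 <= nu p + nu (- p) by rewrite -{1}(subrr p).
by rewrite nuN nu0; lra.
Qed.

Lemma nuX p n : nu (p ^+ n) = nu p ^+ n.
Proof.
elim: n => [|n IH]; first by rewrite !expr0 nu1.
by rewrite !exprS nuM IH.
Qed.

Lemma nuZ c p : nu (c *: p) = `|c| * nu p.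
Proof. by rewrite -mul_polyC nuM nuC. Qed.

(** p^2 is a product of deg p such quadratics, each of value at least m. A single p need not split
    into quadratics, hence the square on the right. *)
Lemma nu_monic_ge (m : R) p : 0 <= m ->
  (forall s t, s ^+ 2 <= 4 * t -> m <= nu (quad s t)) ->
  p \is monic -> m ^+ (size p).-1 <= nu p ^+ 2.
Proof.
move=> m0 mP /sqr_monic_quads[r [rP <- pE]]; rewrite -nuX pE.
elim: r rP {pE} => [|x r IH] rP.
  by rewrite big_nil nu1 expr0.
rewrite big_cons nuM /= exprS ler_pM ?exprn_ge0//.
  by apply/mP/rP; rewrite mem_head.
by apply: IH => y yr; apply: rP; rewrite in_cons yr orbT.
Qed.

(** Changing (s, t) alters [quad s t] by a multiple of X plus a constant, so the triangle inequality
    makes the map Lipschitz. *)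
Lemma nu_quad_continuous : continuous (fun x : R * R => nu (quad x.1 x.2)).
Proof.
move=> x; apply/cvgrPdist_lt => e e0.
have lip y : `|nu (quad x.1 x.2) - nu (quad y.1 y.2)|
    <= `|x.1 - y.1| * nu 'X + `|x.2 - y.2|.
  have lip0 (u v : R * R) : nu (quad u.1 u.2) <= nu (quad v.1 v.2) +
      (`|u.1 - v.1| * nu 'X + `|u.2 - v.2|).
    have -> : quad u.1 u.2 =
        quad v.1 v.2 + (- ((u.1 - v.1) *: 'X) + (u.2 - v.2)%:P).
      by rewrite /quad -!mul_polyC !rmorphB /=; ring.
    apply: (le_trans (nuD _ _)); rewrite lerD2l.
    by apply: (le_trans (nuD _ _)); rewrite nuN nuZ nuC.
  rewrite ler_norml; have := lip0 x y; have := lip0 y x.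
  by rewrite (distrC y.1) (distrC y.2); lra.
have d0 : 0 < e / (nu 'X + 1) by rewrite divr_gt0// ltr_wpDl// nu_ge0.
have /cvgrPdist_lt/(_ _ d0) near1 : y.1 @[y --> x] --> x.1 by exact: cvg_fst.
have /cvgrPdist_lt/(_ _ d0) near2 : y.2 @[y --> x] --> x.2 by exact: cvg_snd.
near=> y; apply: (le_lt_trans (lip y)).
have y1 : `|x.1 - y.1| < e / (nu 'X + 1).
  by near: y; exact: near1.
have y2 : `|x.2 - y.2| < e / (nu 'X + 1).
  by near: y; exact: near2.
have -> : e = e / (nu 'X + 1) * nu 'X + e / (nu 'X + 1).
  by field; rewrite gt_eqF// ltr_wpDl// nu_ge0.
by rewrite ler_ltD// ler_wpM2r ?nu_ge0// ltW.
Unshelve. all: by end_near. Qed.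

(** Confines the quadratics whose value is at most that of X^2 = [quad 0 0] to a box, so that
    minimising over s^2 <= 4t becomes a problem on a compact set. *)
Lemma nu_quad_bound (s t : R) : s ^+ 2 <= 4 * t ->
  nu (quad s t) <= nu 'X ^+ 2 ->
  (- (6 * nu 'X) <= s <= 6 * nu 'X) && (0 <= t <= 8 * nu 'X ^+ 2).
Proof.
move=> st; have := nu_ge0 'X; set a := nu 'X => a0 fa.
have tle : t <= nu (quad s t) + (`|s| * a + a ^+ 2).
  have t0 : 0 <= t by have := sqr_ge0 s; lra.
  rewrite -{1}(ger0_norm t0) -(nuC t).
  have -> : t%:P = quad s t + (s *: 'X - 'X^2) by rewrite /quad; ring.
  apply: (le_trans (nuD _ _)); rewrite lerD2l.
  by apply: (le_trans (nuD _ _)); rewrite nuN nuZ nuX.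
have s2 : `|s| ^+ 2 = s ^+ 2 by rewrite real_normK ?num_real.
(* From t <= 2a^2 + |s| a and s^2 <= 4t, the square of |s| - 4a gives t <= 8a^2. Then s^2 <= 32a^2,
   rounded up to (6a)^2. *)
have t8 : t <= 8 * a ^+ 2 by have := sqr_ge0 (`|s| - 4 * a); nra.
have : `|s| <= 6 * a.
  rewrite -(@ler_pXn2r _ 2) ?nnegrE ?mulr_ge0//; have := sqr_ge0 a; nra.
by rewrite ler_norml => ->; rewrite t8 andbT; have := sqr_ge0 s; lra.
Qed.

(** A minimiser with the largest t is taken. Raising t stays within s^2 <= 4t, so it must increase
    the value strictly. *)
Lemma nu_quad_minimizer : exists s t : R, [/\ s ^+ 2 <= 4 * t,
  forall s' t', s' ^+ 2 <= 4 * t' -> nu (quad s t) <= nu (quad s' t')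
  & forall t', t < t' -> nu (quad s t) < nu (quad s t')].
Proof.
set a := nu 'X; have a0 : 0 <= a := nu_ge0 _.
pose f (x : R * R) := nu (quad x.1 x.2).
pose box := `[- (6 * a), 6 * a]%classic `*` `[0, 8 * a ^+ 2]%classic.
pose g (x : R * R) := x.1 ^+ 2 - 4 * x.2.
pose A := box `&` g @^-1` [set y | y <= 0].
have contD : continuous g.
  move=> x; apply: cvgB; first by apply: cvgM; exact: cvg_fst.
  by apply: cvgM; [exact: cvg_cst|exact: cvg_snd].
have cA : compact A.
  apply: compact_closedI; first by apply: compact_setX; exact: segment_compact.
  apply: (@preimage_closed _ _ g [set y | y <= 0]); last exact: closed_le.
  by move=> x _; exact: contD.
have inA s t : s ^+ 2 <= 4 * t -> f (s, t) <= a ^+ 2 -> A (s, t).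
  move=> st fst; have /andP[sb tb] := nu_quad_bound st fst.
  by split; [split; rewrite /= in_itv|rewrite /g /=; lra].
have f0 : f (0, 0) = a ^+ 2 by rewrite /f /quad /= scale0r subr0 addr0 nuX.
have A0 : A (0, 0) by apply: inA; rewrite ?f0// expr0n mulr0.
have [] := compact_EVT_min _ cA (continuous_subspaceT nu_quad_continuous).
  by exists (0, 0).
move=> c; rewrite inE => Ac cmin.
(* Admissible pairs outside [A] have value above nu(X)^2, the value at (0, 0), so the minimum on [A]
   is global. *)
have cle s t : s ^+ 2 <= 4 * t -> f c <= f (s, t).
  move=> st; have [fa|/ltW fa] := leP (f (s, t)) (a ^+ 2).
    by apply: cmin; rewrite inE; exact: inA.
  by apply: le_trans fa; rewrite -f0; apply: cmin; rewrite inE.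
have cA' : compact (A `&` f @^-1` [set y | y <= f c]).
  apply: compact_closedI => //.
  apply: (@preimage_closed _ _ f [set y | y <= f c]); last exact: closed_le.
  move=> x _.
  exact: nu_quad_continuous.
(* Second extremal problem: the largest t on the compact set of minimisers. *)
have [] := compact_EVT_max _ cA'
  (continuous_subspaceT (fun x : R * R => @cvg_snd _ _ (nbhs x.1) (nbhs x.2) _)).
  by exists c; split => /=.
move=> [s t]; rewrite inE => -[Ast fst] tmax.
have stD : s ^+ 2 <= 4 * t by case: Ast => _; rewrite /g /=; lra.
have fE : f (s, t) = f c by apply/eqP; rewrite eq_le fst cle.
exists s, t; split => //; first by move=> s' t' /cle; rewrite -fE.
move=> t' tt'; rewrite ltNge; apply/negP => f't.
have stD' : s ^+ 2 <= 4 * t' by lra.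
have /tmax /= : (s, t') \in A `&` f @^-1` [set y | y <= f c].
  rewrite inE; split; last by rewrite /preimage /= -fE; exact: f't.
  apply: inA => //; apply: (le_trans f't).
  by rewrite -/(f (s, t)) fE -f0; apply: cle; rewrite expr0n mulr0.
by rewrite leNgt tt'.
Qed.

(* Ostrowski: if the minimum m were positive, compare quad s t + e, whose value
   exceeds m, with its multiple (quad s t)^n - (-e)^n, whose value is at most
   m^n + e^n, and let n tend to infinity. *)
Lemma nu_quad_eq0 : exists s t : R, nu (quad s t) = 0.
Proof.
have [s [t [st mP tP]]] := nu_quad_minimizer; exists s, t.
set m := nu (quad s t) in mP tP *.
have [//|m_neq0] := eqVneq m 0.
have m0 : 0 < m by rewrite lt_neqAle eq_sym m_neq0 nu_ge0.
(* Any e strictly between 0 and m would do; what matters is that (e / m)^n tends to 0. *)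
pose e := m / 2; have e0 : 0 < e by rewrite divr_gt0.
have {}tP := tP (t + e) ltac:(lra).
set f1 := nu _ in tP.
have size_quad u v : size (quad u v) = 3.
  rewrite /quad -addrA size_polyDl ?size_polyXn//.
  rewrite -scaleNr (leq_ltn_trans (size_polyD _ _))// gtn_max.
  by rewrite (leq_ltn_trans (size_scale_leq _ _)) ?size_polyX// (leq_ltn_trans (size_polyC_leq1 _)).
have quad_monic u v : quad u v \is monic.
  rewrite monicE lead_coefE size_quad /quad.
  by rewrite coefD coefB coefXn coefZ coefX coefC /= mulr0 subr0 addr0.
have key n : f1 * m ^+ n <= m ^+ n.+1 + e ^+ n.+1.
  (* [h] is the cofactor of [quad s (t + e)]. It is monic of degree 2n, so [nu_monic_ge] gives nu h
     >= m^n. *)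
  pose h := \sum_(i < n.+1) quad s t ^+ (n.+1.-1 - i) * (- e%:P) ^+ i.
  have GE : quad s t ^+ n.+1 - (- e%:P) ^+ n.+1 = quad s (t + e) * h.
    by rewrite subrXX; congr (_ * _); rewrite /quad polyCD; ring.
  have G_monic : quad s t ^+ n.+1 - (- e%:P) ^+ n.+1 \is monic
      /\ size (quad s t ^+ n.+1 - (- e%:P) ^+ n.+1) = (n.+1 * 2).+1.
    have sq : size (quad s t ^+ n.+1) = (n.+1 * 2).+1.
      have := size_exp (quad s t) n.+1; rewrite size_quad mulnC /= => <-.
      by rewrite prednK// size_poly_gt0 monic_neq0// monic_exp.
    have lt : (size (- (- e%:P) ^+ n.+1 : {poly R}) < size (quad s t ^+ n.+1))%N.
      rewrite sq -polyCN -rmorphXn size_polyN.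
      by rewrite (leq_ltn_trans (size_polyC_leq1 _)).
    by rewrite size_polyDl// sq monicE lead_coefDl// -monicE monic_exp.
  have h_monic : h \is monic.
    by rewrite -(monicMl _ (quad_monic s (t + e))) -GE; case: G_monic.
  have size_h : size h = (n * 2).+1.
    have := G_monic.2; rewrite GE size_monicM ?monic_neq0// size_quad /=.
    by rewrite mulSn => -[].
  have hm : m ^+ n <= nu h.
    rewrite -(@ler_pXn2r _ 2) ?nnegrE ?nu_ge0 ?exprn_ge0 ?(ltW m0)//.
    by rewrite -exprM; have := nu_monic_ge (ltW m0) mP h_monic; rewrite size_h.
  apply: (@le_trans _ _ (f1 * nu h)).
    by rewrite ler_wpM2l ?nu_ge0.
  rewrite /f1 -nuM -GE; apply: (le_trans (nuD _ _)).
  by rewrite nuN !nuX nuN nuC (ger0_norm (ltW e0)).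
(* Dividing [key] by m^(n+1) gives f1 / m <= 1 + 2^-(n+1) for all n, whereas f1 > m. *)
have : (fun n => (2^-1 : R) ^+ n) @ \oo --> (0 : R).
  by apply: cvg_expr; rewrite ger0_norm; lra.
have d0 : 0 < f1 / m - 1 by rewrite subr_gt0 ltr_pdivlMr ?mul1r.
move=> /cvgrPdist_lt/(_ _ d0)[n _ /(_ n.+1 (leqnSn n))].
rewrite sub0r normrN ger0_norm ?exprn_ge0// ?invr_ge0// ltNge => /negP[].
have := key n; rewrite /e exprMn exprS.
have -> : m * m ^+ n + m * m ^+ n * 2^-1 ^+ n.+1 = m * (1 + 2^-1 ^+ n.+1) * m ^+ n.
  by ring.
by rewrite ler_pM2r ?exprn_gt0// lerBlDl ler_pdivrMr// mulrC.
Qed.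

End MultiplicativeSeminorm.

(* The scalar field K is R, with iota and re the identity, or R[i], with iota the
   inclusion of R and re the real part. *)
Section ScalarField.
Variables (R : realType) (K : numFieldType).
Variables (iota : {rmorphism R -> K}) (re : K -> R).
Hypothesis iota_le : forall a b : R, (iota a <= iota b) = (a <= b).
Hypothesis iota_re : forall c : K, 0 <= c -> iota (re c) = c.
Hypothesis K_complete : forall u : nat -> K,
  (forall e : R, 0 < e -> exists N : nat, forall i j : nat,
     (N <= i)%N -> (N <= j)%N -> re `|u i - u j| < e) ->
  exists l : K, forall e : R, 0 < e -> exists N : nat, forall j : nat,
     (N <= j)%N -> re `|u j - l| < e.

Let iota_inj : injective iota.
Proof. by move=> a b ab; apply/eqP; rewrite eq_le -!iota_le ab lexx. Qed.

Let iota_lt a b : (iota a < iota b) = (a < b).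
Proof. by rewrite !lt_neqAle iota_le (inj_eq iota_inj). Qed.

Let re_norm_iota (a : R) : re `|iota a| = `|a|.
Proof.
apply: iota_inj; rewrite iota_re//; have [a0|/ltW a0] := leP 0 a.
  have ia0 : 0 <= iota a by rewrite -(rmorph0 iota) iota_le.
  by rewrite !ger0_norm.
have ia0 : iota a <= 0 by rewrite -(rmorph0 iota) iota_le.
by rewrite !ler0_norm// rmorphN.
Qed.

(** * Real-valued norms and closedness of finite-dimensional spans *)

Section NormedModule.
Variable X : normedModType K.
Implicit Types (x y : X) (c : K).

Definition rnorm x : R := re `|x|.

Lemma iota_rnorm x : iota (rnorm x) = `|x|. Proof. exact: iota_re. Qed.

Lemma rnorm_ge0 x : 0 <= rnorm x.
Proof. by rewrite -iota_le rmorph0 iota_rnorm. Qed.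

Lemma rnormD x y : rnorm (x + y) <= rnorm x + rnorm y.
Proof. by rewrite -iota_le rmorphD /= !iota_rnorm ler_normD. Qed.

Lemma rnormN x : rnorm (- x) = rnorm x.
Proof. by rewrite /rnorm normrN. Qed.

Lemma rnormZ c x : rnorm (c *: x) = re `|c| * rnorm x.
Proof.
by apply: iota_inj; rewrite rmorphM /= !iota_rnorm normrZ iota_re.
Qed.

Lemma rnorm0 : rnorm 0 = 0.
Proof. by apply: iota_inj; rewrite iota_rnorm normr0 rmorph0. Qed.

Lemma rnorm_eq0 x : (rnorm x == 0) = (x == 0).
Proof. by rewrite -(inj_eq iota_inj) rmorph0 iota_rnorm normr_eq0. Qed.

Lemma rnorm_gt0 x : (0 < rnorm x) = (x != 0).
Proof. by rewrite lt_neqAle rnorm_ge0 andbT eq_sym rnorm_eq0. Qed.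

Lemma re_norm_ge0 c : 0 <= re `|c|.
Proof. by rewrite -iota_le iota_re// rmorph0. Qed.

(** Induction on n. If the last generator is in the closure of the span of the others, it is
    redundant. Otherwise it has a positive distance d to that span, and the last coefficient of a
    combination is at most its norm over d. So the last coefficients of approximations of x are
    Cauchy, and subtracting the limit term reduces to fewer generators. *)
Lemma span_closed (e : nat -> X) n x :
  (forall d : R, 0 < d ->
     exists c : nat -> K, rnorm (x - \sum_(i < n) c i *: e i) < d) ->
  exists c : nat -> K, x = \sum_(i < n) c i *: e i.
Proof.
elim: n x => [|n IH] x xP.
  exists (fun=> 0); rewrite big_ord0; apply/eqP; rewrite -rnorm_eq0.
  rewrite eq_le rnorm_ge0 andbT leNgt; apply/negP => /xP[c].
  by rewrite big_ord0 subr0 ltxx.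
have extend (c : nat -> K) l : \sum_(i < n) c i *: e i + l *: e n =
    \sum_(i < n.+1) (if (i < n)%N then c i else l) *: e i.
  rewrite big_ord_recr /= ltnn; congr (_ + _).
  by apply: eq_bigr => i _; rewrite ltn_ord.
have [[d [d0 dP]]|nd] := pselect (exists d, 0 < d /\
    forall c : nat -> K, d <= rnorm (e n - \sum_(i < n) c i *: e i)); last first.
  have [a aE] : exists a : nat -> K, e n = \sum_(i < n) a i *: e i.
    apply: IH => d d0; apply/not_existsP => nc; apply: nd.
    by exists d; split => // c; rewrite leNgt; apply/negP/nc.
  have [c ->] : exists c : nat -> K, x = \sum_(i < n) c i *: e i.
    apply: IH => d /xP[c cP]; exists (fun i => c i + c n * a i).
    congr (rnorm (_ - _) < _) : cP; rewrite big_ord_recr /= aE scaler_sumr.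
    by rewrite -big_split; apply: eq_bigr => i _; rewrite scalerDl scalerA.
  exists (fun i => if (i < n)%N then c i else 0).
  by rewrite -extend scale0r addr0.
have coef_le (c : nat -> K) :
    re `|c n| * d <= rnorm (\sum_(i < n.+1) c i *: e i).
  have [->|cn0] := eqVneq (c n) 0.
    by rewrite -(rmorph0 iota) re_norm_iota normr0 mul0r rnorm_ge0.
  have -> : \sum_(i < n.+1) c i *: e i =
      c n *: (e n - \sum_(i < n) (- (c n)^-1 * c i) *: e i).
    rewrite big_ord_recr /= scalerBr addrC scaler_sumr -sumrN; congr (_ + _).
    apply: eq_bigr => i _.
    by rewrite scalerA mulrA mulrN divff// mulN1r scaleNr opprK.
  by rewrite rnormZ ler_wpM2l ?re_norm_ge0// (dP (fun i => - (c n)^-1 * c i)).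
have /choice[u uP] (j : nat) : exists c : nat -> K,
    rnorm (x - \sum_(i < n.+1) c i *: e i) < j.+1%:R^-1.
  by apply: xP; rewrite invr_gt0.
have inv_lt (r : R) : 0 < r -> exists N : nat, forall j, (N <= j)%N -> j.+1%:R^-1 < r.
  by move=> r0; have [N _ NP] := near_infty_natSinv_lt (PosNum r0); exists N.
have [l lP] : exists l : K, forall e : R, 0 < e -> exists N : nat, forall j : nat,
     (N <= j)%N -> re `|u j n - l| < e.
  apply: K_complete => r r0.
  (* Approximations within r d / 2 of x differ by less than r d, hence their last coefficients by
     less than r. *)
  have [|N NP] := inv_lt (r * d / 2); first by rewrite divr_gt0// mulr_gt0.
  exists N => i j Ni Nj.
  rewrite -(ltr_pM2r d0); apply: (le_lt_trans (coef_le (fun m => u i m - u j m))).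
  have -> : \sum_(m < n.+1) (u i m - u j m) *: e m =
     - (x - \sum_(m < n.+1) u i m *: e m) + (x - \sum_(m < n.+1) u j m *: e m).
    rewrite opprB addrA subrK -sumrB; apply: eq_bigr => m _; exact: scalerBl.
  apply: (le_lt_trans (rnormD _ _)); rewrite rnormN.
  by have := lt_trans (uP i) (NP _ Ni); have := lt_trans (uP j) (NP _ Nj); lra.
have [c cE] : exists c : nat -> K, x - l *: e n = \sum_(i < n) c i *: e i.
  apply: IH => r r0.
  have b0 : 0 < rnorm (e n) + 1 by rewrite ltr_wpDl ?rnorm_ge0.
  have [|N1 N1P] := inv_lt (r / 2); first by rewrite divr_gt0.
  have [|N2 N2P] := lP (r / 2 / (rnorm (e n) + 1)); first by rewrite !divr_gt0.
  exists (u (maxn N1 N2)); set j := maxn N1 N2.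
  have -> : x - l *: e n - \sum_(i < n) u j i *: e i =
      (x - \sum_(i < n.+1) u j i *: e i) + (u j n - l) *: e n.
    rewrite big_ord_recr /= scalerBl opprD !addrA subrK.
    by rewrite -!addrA [X in x + X]addrC.
  apply: (le_lt_trans (rnormD _ _)); rewrite rnormZ.
  have h1 := lt_trans (uP j) (N1P j (leq_maxl _ _)).
  have := N2P j (leq_maxr _ _); rewrite ltr_pdivlMr// => h2.
  by have := re_norm_ge0 (u j n - l); lra.
by exists (fun i => if (i < n)%N then c i else l); rewrite -extend -cE subrK.
Qed.

End NormedModule.

(** * The seminorm limsup |T^n x| of a power bounded operator *)

Section PowerBounded.
Variables (X : normedModType K) (T : {linear X -> X}) (M : R).
Hypothesis M_ge0 : 0 <= M.
Hypothesis powM : forall n x, rnorm (iter n T x) <= M * rnorm x.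
Implicit Types (x y : X) (c : K).

Lemma iter_linearD n x y : iter n T (x + y) = iter n T x + iter n T y.
Proof. by elim: n => //= n ->; rewrite linearD. Qed.

Lemma iter_linearZ n c x : iter n T (c *: x) = c *: iter n T x.
Proof. by elim: n => //= n ->; rewrite linearZ. Qed.

Definition orbit_sup x : R := sup (range (fun n => rnorm (iter n T x))).

Lemma rnorm_iter_orbit_sup n x : rnorm (iter n T x) <= orbit_sup x.
Proof.
apply: ub_le_sup; last by exists n.
by exists (M * rnorm x) => _ [m _ <-]; exact: powM.
Qed.

Lemma orbit_sup_le x b :
  (forall n, rnorm (iter n T x) <= b) -> orbit_sup x <= b.
Proof.
move=> xb; apply: ge_sup; first by exists (rnorm x); exists 0%N.
by move=> _ [n _ <-].
Qed.

Lemma orbit_sup_iter_homo x m n : (m <= n)%N ->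
  orbit_sup (iter n T x) <= orbit_sup (iter m T x).
Proof.
move=> mn; apply: orbit_sup_le => i.
have -> : iter i T (iter n T x) = iter (i + (n - m)) T (iter m T x).
  by rewrite -!iterD -addnA subnK.
exact: rnorm_iter_orbit_sup.
Qed.

(** The tail suprema [orbit_sup (iter n T x)] are nonincreasing in n, so their infimum is the limsup
    of |T^n x|. *)
Definition limsup_norm x : R := inf (range (fun n => orbit_sup (iter n T x))).

Let orbit_sup_ge0 x : 0 <= orbit_sup x.
Proof. exact: le_trans (rnorm_ge0 x) (rnorm_iter_orbit_sup 0 x). Qed.

Let orbit_sup_has_lbound x :
  has_lbound (range (fun n => orbit_sup (iter n T x))).
Proof. by exists 0 => _ [n _ <-]. Qed.

Lemma limsup_norm_le n x : limsup_norm x <= orbit_sup (iter n T x).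
Proof. by apply: ge_inf => //; exists n. Qed.

(** Monotonicity of the tail suprema extends one good index to all later ones. *)
Lemma limsup_norm_adherent x e : 0 < e -> exists N : nat,
  forall n, (N <= n)%N -> orbit_sup (iter n T x) < limsup_norm x + e.
Proof.
move=> e0; have hi : has_inf (range (fun n => orbit_sup (iter n T x))).
  by split; [exists (orbit_sup x); exists 0%N|exact: orbit_sup_has_lbound].
have [_ [N _ <-] NP] := inf_adherent e0 hi.
by exists N => n Nn; apply: le_lt_trans NP; exact: orbit_sup_iter_homo.
Qed.

Lemma limsup_norm_ge0 x : 0 <= limsup_norm x.
Proof.
by apply: lb_le_inf => [|_ [n _ <-]//]; exists (orbit_sup x); exists 0%N.
Qed.

Lemma limsup_norm_le_rnorm x : limsup_norm x <= M * rnorm x.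
Proof.
by apply: le_trans (limsup_norm_le 0 x) _; apply: orbit_sup_le => n; exact: powM.
Qed.

Lemma limsup_normD x y : limsup_norm (x + y) <= limsup_norm x + limsup_norm y.
Proof.
apply/ler_addgt0Pr => e e0; have e20 : 0 < e / 2 by rewrite divr_gt0.
have [Nx NxP] := limsup_norm_adherent x e20.
have [Ny NyP] := limsup_norm_adherent y e20.
set n := maxn Nx Ny; apply: (le_trans (limsup_norm_le n _)).
have : orbit_sup (iter n T (x + y))
    <= orbit_sup (iter n T x) + orbit_sup (iter n T y).
  apply: orbit_sup_le => i; rewrite !iter_linearD.
  by apply: (le_trans (rnormD _ _)); rewrite lerD ?rnorm_iter_orbit_sup.
by have := NxP n (leq_maxl _ _); have := NyP n (leq_maxr _ _); lra.
Qed.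

(** The inequality from left to right holds for every scalar; applied to c^-1 it gives the
    converse. *)
Lemma limsup_normZ c x : limsup_norm (c *: x) = re `|c| * limsup_norm x.
Proof.
have le d y : limsup_norm (d *: y) <= re `|d| * limsup_norm y.
  apply/ler_addgt0Pr => e e0.
  have b0 : 0 < re `|d| + 1 by rewrite ltr_wpDl ?re_norm_ge0.
  have [N /(_ _ (leqnn N)) NP] := limsup_norm_adherent y (divr_gt0 e0 b0).
  apply: (le_trans (limsup_norm_le N _)).
  have : orbit_sup (iter N T (d *: y)) <= re `|d| * orbit_sup (iter N T y).
    apply: orbit_sup_le => i; rewrite !iter_linearZ rnormZ.
    by rewrite ler_wpM2l ?re_norm_ge0 ?rnorm_iter_orbit_sup.
  move=> /le_trans; apply.
  apply: (@le_trans _ _ (re `|d| * (limsup_norm y + e / (re `|d| + 1)))).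
    by rewrite ler_wpM2l ?re_norm_ge0// ltW.
  rewrite mulrDr lerD2l mulrA ler_pdivrMr// mulrC ler_wpM2l ?(ltW e0)//; lra.
have [->|c0] := eqVneq c 0.
  have re0 : re `|0 : K| = 0 by rewrite -(rmorph0 iota) re_norm_iota normr0.
  rewrite scale0r re0 mul0r; apply/eqP; rewrite eq_le limsup_norm_ge0 andbT.
  by apply: (le_trans (limsup_norm_le_rnorm _)); rewrite rnorm0 mulr0.
apply/eqP; rewrite eq_le le /=.
have cc : re `|c| * re `|c^-1| = 1.
  by apply: iota_inj; rewrite rmorphM rmorph1 /= !iota_re// normfV divff// normr_eq0.
have := le c^-1 (c *: x); rewrite scalerA mulVf// scale1r => h.
rewrite -[leRHS]mul1r -cc -mulrA ler_wpM2l ?re_norm_ge0//.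
Qed.

(** Continuity in Lipschitz form, used to pass from the dense multiples of an orbit to all of X. *)
Lemma limsup_normB_le x y : limsup_norm x <= limsup_norm y + M * rnorm (x - y).
Proof.
rewrite -{1}(subrK y x) addrC; apply: (le_trans (limsup_normD _ _)).
by rewrite lerD2l limsup_norm_le_rnorm.
Qed.

(** Dropping the first term of an orbit leaves its limsup unchanged. *)
Lemma limsup_normT x : limsup_norm (T x) = limsup_norm x.
Proof.
apply/eqP; rewrite eq_le; apply/andP; split; apply/ler_addgt0Pr => e e0.
  have [N NP] := limsup_norm_adherent x e0.
  apply: (le_trans (limsup_norm_le N _)); rewrite -iterSr.
  exact/ltW/NP.
have [N NP] := limsup_norm_adherent (T x) e0.
apply: (le_trans (limsup_norm_le N.+1 _)); rewrite iterSr.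
exact/ltW/NP.
Qed.

Lemma limsup_norm_iter n x : limsup_norm (iter n T x) = limsup_norm x.
Proof. by elim: n => //= n <-; exact: limsup_normT. Qed.

Lemma limsup_norm_eq0 x : limsup_norm x = 0 -> forall e : R, 0 < e ->
  exists N : nat, forall n, (N <= n)%N -> rnorm (iter n T x) < e.
Proof.
move=> x0 e /(limsup_norm_adherent x)[N NP]; exists N => n /NP.
by rewrite x0 add0r; apply: le_lt_trans; exact: (rnorm_iter_orbit_sup 0).
Qed.

(** * Real polynomials in T *)

(** This is p(T) x. The coefficients stay real over the complex field too, since Ostrowski's theorem
    is applied to real polynomials. *)
Definition poly_act (p : {poly R}) x : X :=
  \sum_(i < size p) iota p`_i *: iter i T x.

Lemma poly_act_widen (p : {poly R}) x n : (size p <= n)%N ->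
  poly_act p x = \sum_(i < n) iota p`_i *: iter i T x.
Proof.
move=> pn; rewrite /poly_act.
rewrite -!(big_mkord xpredT (fun i => iota p`_i *: iter i T x)).
rewrite [RHS](big_cat_nat (n := size p))//= [X in _ + X]big_nat_cond.
rewrite [X in _ + X]big1 ?addr0// => i; rewrite andbT => /andP[pi _].
by rewrite nth_default// rmorph0 scale0r.
Qed.

Lemma poly_actDl (p q : {poly R}) x :
  poly_act (p + q) x = poly_act p x + poly_act q x.
Proof.
set n := maxn (size p) (size q).
rewrite (poly_act_widen x (size_polyD p q)).
rewrite (poly_act_widen x (leq_maxl (size p) (size q))).
rewrite (poly_act_widen x (leq_maxr (size p) (size q))).
rewrite -big_split; apply: eq_bigr => i _.
by rewrite coefD rmorphD scalerDl.
Qed.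

Lemma poly_actC (a : R) x : poly_act a%:P x = iota a *: x.
Proof.
by rewrite (poly_act_widen x (size_polyC_leq1 a)) big_ord1 coefC.
Qed.

Lemma poly_actZl (a : R) (p : {poly R}) x :
  poly_act (a *: p) x = iota a *: poly_act p x.
Proof.
rewrite (poly_act_widen x (size_scale_leq a p)) scaler_sumr.
by apply: eq_bigr => i _; rewrite coefZ rmorphM scalerA.
Qed.

Lemma poly_actMX (p : {poly R}) x : poly_act (p * 'X) x = T (poly_act p x).
Proof.
have sz : (size (p * 'X)%R <= (size p).+1)%N.
  by rewrite (leq_trans (size_polyMleq _ _))// size_polyX addn2.
rewrite (poly_act_widen x sz) big_ord_recl coefMX /= rmorph0 scale0r add0r.
by rewrite linear_sum; apply: eq_bigr => i _; rewrite coefMX /= linearZ.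
Qed.

Lemma poly_actX x : poly_act 'X x = T x.
Proof.
by rewrite -(mul1r 'X) poly_actMX -polyC1 poly_actC rmorph1 scale1r.
Qed.

Lemma poly_actM (p q : {poly R}) x :
  poly_act (p * q) x = poly_act p (poly_act q x).
Proof.
elim/poly_ind: p => [|p c IH].
  by rewrite mul0r /poly_act size_poly0 !big_ord0.
by rewrite mulrDl mulrAC !poly_actDl !poly_actMX IH mul_polyC poly_actZl poly_actC.
Qed.

Lemma poly_actD (p : {poly R}) x y :
  poly_act p (x + y) = poly_act p x + poly_act p y.
Proof.
by rewrite -big_split; apply: eq_bigr => i _; rewrite iter_linearD scalerDr.
Qed.

Lemma poly_actZ (p : {poly R}) c x : poly_act p (c *: x) = c *: poly_act p x.
Proof.
rewrite /poly_act scaler_sumr; apply: eq_bigr => i _.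
by rewrite iter_linearZ !scalerA mulrC.
Qed.

Lemma poly_act_iter (p : {poly R}) n x :
  poly_act p (iter n T x) = iter n T (poly_act p x).
Proof.
elim: n => //= n <-; rewrite /poly_act linear_sum; apply: eq_bigr => i _.
by rewrite linearZ /= -iterS -iterSr.
Qed.

(** Horner's scheme; the bound on T itself is [powM] at exponent 1. *)
Lemma poly_act_bounded (p : {poly R}) : exists C : R,
  0 <= C /\ forall x, rnorm (poly_act p x) <= C * rnorm x.
Proof.
elim/poly_ind: p => [|p a [C [C0 CP]]].
  exists 0; split=> // x.
  by rewrite /poly_act size_poly0 big_ord0 rnorm0 mul0r.
exists (M * C + `|a|); split; first by rewrite addr_ge0// mulr_ge0.
move=> x; rewrite poly_actDl poly_actMX poly_actC mulrDl.
apply: (le_trans (rnormD _ _)); rewrite rnormZ re_norm_iota lerD2r.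
apply: (le_trans (powM 1 _)).
by rewrite -mulrA ler_wpM2l.
Qed.

(** * Consequences of a supercyclic vector *)

Section Supercyclic.
Variable k : X.
Hypothesis kP : forall x (e : R), 0 < e ->
  exists (l : K) (n : nat), rnorm (x - l *: iter n T k) < e.

(* Both sides are continuous in x and agree on the multiples of the orbit of k. *)
Lemma limsup_norm_poly_act (p : {poly R}) x :
  limsup_norm (poly_act p x) * limsup_norm k =
  limsup_norm (poly_act p k) * limsup_norm x.
Proof.
have [C [C0 CP]] := poly_act_bounded p.
set b := limsup_norm k; set a := limsup_norm (poly_act p k).
have b0 : 0 <= b := limsup_norm_ge0 _; have a0 : 0 <= a := limsup_norm_ge0 _.
(* [M * C * b] and [a * M] are Lipschitz constants in x of the two sides. *)
pose L := M * C * b + a * M.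
have L0 : 0 <= L by rewrite addr_ge0// !mulr_ge0.
have lip d : 0 < d -> `|limsup_norm (poly_act p x) * b - a * limsup_norm x| <= L * d.
  move=> /(kP x)[l [n]]; set y := l *: _ => xy.
  (* For y = l T^n k both sides equal |l| a b, by homogeneity and invariance under T. *)
  have yE : limsup_norm (poly_act p y) * b = a * limsup_norm y.
    by rewrite poly_actZ poly_act_iter !limsup_normZ !limsup_norm_iter mulrAC mulrC mulrA.
  have pB u v : limsup_norm (poly_act p u)
      <= limsup_norm (poly_act p v) + M * C * rnorm (u - v).
    apply: (le_trans (limsup_normB_le _ (poly_act p v))).
    rewrite lerD2l -mulrA ler_wpM2l//.
    by rewrite -scaleN1r -poly_actZ -poly_actD scaleN1r.
  have xyC : rnorm (y - x) = rnorm (x - y) by rewrite -rnormN opprB.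
  have d1 := pB x y; have d2 := pB y x.
  have d3 := limsup_normB_le x y; have d4 := limsup_normB_le y x.
  rewrite xyC in d2 d4; rewrite ler_norml.
  have e1 := ler_wpM2r b0 d1; have e2 := ler_wpM2r b0 d2.
  have e3 := ler_wpM2l a0 d3; have e4 := ler_wpM2l a0 d4.
  have e5 : L * rnorm (x - y) <= L * d by rewrite ler_wpM2l// ltW.
  rewrite /L in e5 *.
  rewrite !mulrDl !mulrDr !mulrA in e1 e2 e3 e4 e5 *.
  rewrite -!(mulrAC _ b) in e1 e2 e5 *.
  by apply/andP; split; lra.
apply/eqP; rewrite -subr_eq0 -normr_eq0 eq_le normr_ge0 andbT.
apply/ler_addgt0Pr => e e0; rewrite add0r.
have L1 : 0 < L + 1 by rewrite ltr_wpDl.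
apply: (le_trans (lip _ (divr_gt0 e0 L1))).
by rewrite mulrA ler_pdivrMr// mulrC ler_wpM2l ?(ltW e0)//; lra.
Qed.

(** The span is closed and contains every multiple of the orbit of k, a dense set. *)
Lemma supercyclic_span n : (forall i, exists c : nat -> K,
    iter i T k = \sum_(j < n) c j *: iter j T k) -> finite_dimensional X.
Proof.
move=> /choice[c cP]; exists n, (fun j => iter j T k) => x.
have [b ->] : exists b : nat -> K, x = \sum_(j < n) b j *: iter j T k.
  apply: (span_closed (e := fun j => iter j T k)) => d /(kP x)[l [m]].
  rewrite cP scaler_sumr => h; exists (fun j => l * c m j).
  by under eq_bigr do rewrite -scalerA.
by exists (fun j => b j).
Qed.

Lemma limsup_norm_quad_eq0 : 0 < limsup_norm k ->
  exists s t : R, limsup_norm (poly_act (quad s t) k) = 0.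
Proof.
move=> k0; have kn0 : limsup_norm k != 0 by rewrite gt_eqF.
pose nu p := limsup_norm (poly_act p k) / limsup_norm k.
(* This is [limsup_norm_poly_act] for p at the vector q(T) k. *)
have nuM p q : nu (p * q) = nu p * nu q.
  rewrite /nu poly_actM -[X in X / _ = _](mulfK kn0) limsup_norm_poly_act.
  by rewrite [RHS]mulrACA mulrA.
have nuD p q : nu (p + q) <= nu p + nu q.
  by rewrite -mulrDl ler_pM2r ?invr_gt0// poly_actDl limsup_normD.
have nuC (a : R) : nu a%:P = `|a|.
  by rewrite /nu poly_actC limsup_normZ re_norm_iota mulfK.
have [s [t]] := nu_quad_eq0 nuM nuD nuC; exists s, t.
by apply/eqP; rewrite -(mulIr_eq0 _ (mulIf (invr_neq0 kn0))); apply/eqP.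
Qed.

(** If p(T) k is nonzero while T^n p(T) k tends to 0, the multiples of T^n k with n large stay away
    from k. So a small ball around k lies in the closed span of finitely many iterates, and by
    scaling so does the whole orbit. *)
Lemma poly_act_eq0_or_finite_dim (p : {poly R}) : 0 < limsup_norm k ->
  limsup_norm (poly_act p k) = 0 ->
  poly_act p k = 0 \/ finite_dimensional X.
Proof.
move=> k0 pk0; have [pk|pk] := eqVneq (poly_act p k) 0; [by left|right].
have [C [C0 CP]] := poly_act_bounded p.
set d := rnorm (poly_act p k) / 2.
have d0 : 0 < d by rewrite divr_gt0// rnorm_gt0.
have [N NP] := limsup_norm_eq0 pk0 (divr_gt0 d0 (ltr0Sn R 1)).
(* For y = l T^n k within r of k, the first bound gives |p(T)(k - y)| < d and the second |l| <=
   2. *)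
pose r := Num.min (d / (C + 1)) (limsup_norm k / (M + 1)).
have C1 : 0 < C + 1 by rewrite ltr_wpDl.
have M1 : 0 < M + 1 by rewrite ltr_wpDl.
have r0 : 0 < r by rewrite /r lt_min; apply/andP; split; apply: divr_gt0.
have ball_orbit l n : rnorm (k - l *: iter n T k) < r -> (n < N)%N.
  rewrite lt_min (ltr_pdivlMr _ _ C1) (ltr_pdivlMr _ _ M1) => /andP[lC lM].
  rewrite ltnNge; apply/negP => /NP small.
  set y := l *: iter n T k in lC lM.
  have ky : rnorm (y - k) = rnorm (k - y) by rewrite -rnormN opprB.
  have l2 : re `|l| <= 2.
    have := limsup_normB_le y k; rewrite ky limsup_normZ limsup_norm_iter => h.
    have := rnorm_ge0 (k - y) => h'.
    by rewrite -(ler_pM2r k0); lra.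
  (* For n >= N this leads to 2d = |p(T) k| < 2 (d / 2) + d, a contradiction. *)
  have : rnorm (poly_act p k) <= rnorm (poly_act p y) + C * rnorm (k - y).
    rewrite -{1}(subrK y k) addrC poly_actD.
    by apply: (le_trans (rnormD _ _)); rewrite lerD2l.
  rewrite poly_actZ poly_act_iter rnormZ.
  have h1 := rnorm_ge0 (k - y); have h2 := rnorm_ge0 (iter n T (poly_act p k)).
  have : re `|l| * rnorm (iter n T (poly_act p k))
      <= 2 * rnorm (iter n T (poly_act p k)) by rewrite ler_wpM2r.
  by rewrite /d in small lC; lra.
have in_span x : rnorm (k - x) < r ->
    exists c : nat -> K, x = \sum_(j < N) c j *: iter j T k.
  move=> kx; apply: (span_closed (e := fun j => iter j T k)) => e e0.
  (* The second bound keeps the approximation of x inside the ball of radius r around k. *)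
  have m0 : 0 < Num.min e (r - rnorm (k - x)) by rewrite lt_min e0 subr_gt0.
  have [l [n]] := kP x m0; rewrite lt_min => /andP[xe xr].
  have nN : (n < N)%N.
    apply: (ball_orbit l).
    rewrite -[k in k - _](subrK x k) -addrA.
    by apply: (le_lt_trans (rnormD _ _)); lra.
  exists (fun j => if j == n then l else 0).
  rewrite (bigD1 (Ordinal nN))//= eqxx big1 ?addr0// => j /negPf.
  by rewrite -val_eqE /= => ->; rewrite scale0r.
have [b bE] : exists c : nat -> K, k = \sum_(j < N) c j *: iter j T k.
  by apply: in_span; rewrite subrr rnorm0.
apply: (@supercyclic_span N) => i.
set x := iter i T k.
have x1 : 0 < rnorm x + 1 by rewrite ltr_wpDl ?rnorm_ge0.
(* With this a, k + a x is still in the ball, and x is recovered from the difference of two vectors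
   of the span. *)
pose a := iota (r / (rnorm x + 1)).
have a0 : a != 0.
  by rewrite -(rmorph0 iota) (inj_eq iota_inj) gt_eqF// divr_gt0.
have [c cE] : exists c : nat -> K, k + a *: x = \sum_(j < N) c j *: iter j T k.
  apply: in_span; rewrite opprD addrA subrr add0r rnormN rnormZ re_norm_iota.
  rewrite ger0_norm; last by rewrite divr_ge0// ltW.
  rewrite mulrAC ltr_pdivrMr// ltr_pM2l//; lra.
exists (fun j => a^-1 * (c j - b j)).
transitivity (a^-1 *: (k + a *: x - k)).
  by rewrite addrC addKr scalerA mulVf// scale1r.
rewrite cE {2}bE -sumrB scaler_sumr; apply: eq_bigr => j _.
by rewrite -scalerBl scalerA.
Qed.

Lemma supercyclic_limsup_norm0 : ~ finite_dimensional X ->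
  forall x, limsup_norm x = 0.
Proof.
move=> nfd; have [k0 x|kn0] := eqVneq (limsup_norm k) 0.
  apply/eqP; rewrite eq_le limsup_norm_ge0 andbT.
  apply/ler_addgt0Pr => e e0; rewrite add0r.
  have M1 : 0 < M + 1 by rewrite ltr_wpDl.
  have [l [n xe]] := kP x (divr_gt0 e0 M1).
  (* The seminorm vanishes on multiples of the orbit, so its value at x is at most M times the
     distance from x to one of them. *)
  apply: (le_trans (limsup_normB_le x (l *: iter n T k))).
  rewrite limsup_normZ limsup_norm_iter k0 mulr0 add0r.
  move: xe; rewrite ltr_pdivlMr// => xe.
  by have := rnorm_ge0 (x - l *: iter n T k); lra.
have k0 : 0 < limsup_norm k by rewrite lt_neqAle eq_sym kn0 limsup_norm_ge0.
have [s [t /(poly_act_eq0_or_finite_dim k0)[qk|//]]] := limsup_norm_quad_eq0 k0.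
exfalso; apply: nfd; apply: (@supercyclic_span 2).
have TT : T (T k) = iota s *: T k - iota t *: k.
  move: qk; rewrite /quad !poly_actDl -scaleNr poly_actZl poly_actC expr2.
  rewrite poly_actM !poly_actX rmorphN scaleNr /= => h.
  by apply/eqP; rewrite -subr_eq0 opprB addrA addrAC h.
elim=> [|i [c cE]].
  exists (fun j => (j == 0%N)%:R).
  by rewrite big_ord_recl big_ord1 /= scale1r scale0r addr0.
(* T (c0 k + c1 T k) = - c1 t k + (c0 + c1 s) T k. *)
exists (fun j => if j == 0%N then c 1%N * - iota t else c 0%N + c 1%N * iota s).
rewrite iterS cE !big_ord_recl !big_ord0 /= !addr0 linearD !linearZ /= TT.
by rewrite scalerBr !scalerA mulrN scaleNr scalerDl addrA [RHS]addrC.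
Qed.

End Supercyclic.
End PowerBounded.

(** * From the definitions to real estimates, and both results over K *)

Lemma supercyclic_approx (X : normedModType K) (T : {linear X -> X}) :
  supercyclic T -> exists k : X, forall x (e : R), 0 < e ->
    exists (l : K) (n : nat), rnorm (x - l *: iter n T k) < e.
Proof.
move=> [k kP]; exists k => x e e0.
have ie0 : 0 < iota e by rewrite -(rmorph0 iota) iota_lt.
have [||y [xy [l [n yE]]]] := kP (ball x (iota e)).
- by exists x; exact: ballxx.
- exact: ball_open.
exists l, n; rewrite -yE; move: xy; rewrite -ball_normE /= -iota_rnorm.
by rewrite iota_lt.
Qed.

Lemma power_bounded_bound (X : normedModType K) (T : {linear X -> X}) :
  power_bounded re T -> exists M : R,
    0 <= M /\ forall n x, rnorm (iter n T x) <= M * rnorm x.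
Proof.
rewrite /power_bounded; set S := ereal_sup _ => S_lty.
have S_ge n x : `|x| <= 1 -> ((rnorm (iter n T x))%:E <= S)%E.
  move=> x1; apply: (@le_trans _ _ (opnorm re (iter n T))).
    by apply: ereal_sup_ubound; exists x.
  by apply: ereal_sup_ubound; exists n.
(* The vector 0 of the unit ball excludes the value -oo, so [S] is finite. *)
have S_ge0 : (0 <= S)%E.
  by have := S_ge 0%N 0; rewrite normr0 /= rnorm0; apply.
have SE : S = (fine S)%:E by rewrite fineK// ge0_fin_numE.
exists (fine S); split; first exact: fine_ge0.
move=> n x; have [->|x0] := eqVneq x 0.
  have -> : iter n T 0 = 0 by elim: n => //= n ->; rewrite linear0.
  by rewrite rnorm0 mulr0.
have nx0 : 0 < rnorm x by rewrite rnorm_gt0.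
(* The operator norm tests only the unit ball, so x is normalised first. *)
have := S_ge n (iota (rnorm x)^-1 *: x).
rewrite iter_linearZ rnormZ re_norm_iota gtr0_norm ?invr_gt0// SE lee_fin.
rewrite mulrC ler_pdivrMr//; apply.
rewrite -iota_rnorm rnormZ re_norm_iota gtr0_norm ?invr_gt0// mulVf ?gt_eqF//.
by rewrite rmorph1.
Qed.

Lemma power_bounded_supercyclic_cvg0 (X : normedModType K)
    (T : {linear X -> X}) (M : R) : 0 <= M ->
  (forall n x, rnorm (iter n T x) <= M * rnorm x) ->
  ~ finite_dimensional X -> supercyclic T ->
  forall x, iter n T x @[n --> \oo] --> (0 : X).
Proof.
move=> M0 powM nfd /supercyclic_approx[k kP] x.
have x0 := supercyclic_limsup_norm0 M0 powM kP nfd x.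
apply/cvgrPdist_lt => e e0.
have re0 : 0 < re e by rewrite -iota_lt rmorph0 iota_re// ltW.
have [N NP] := limsup_norm_eq0 powM x0 re0.
exists N => // n /= /NP; rewrite -iota_lt iota_rnorm iota_re ?ltW//.
by rewrite sub0r normrN.
Qed.

(** For an isometry M = 1 works, and T^n x keeps the norm of x, so a vanishing limsup forces x = 0.
    The zero space is spanned by the empty family. *)
Lemma isometry_not_supercyclic (X : normedModType K) (T : {linear X -> X}) :
  ~ finite_dimensional X -> linear_isometry T -> ~ supercyclic T.
Proof.
move=> nfd isoT scT.
have iterE n x : rnorm (iter n T x) = rnorm x.
  by elim: n => //= n <-; rewrite /rnorm isoT.
have powM n x : rnorm (iter n T x) <= 1 * rnorm x by rewrite iterE mul1r.
have [k kP] := supercyclic_approx scT.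
have all0 (x : X) : x = 0.
  apply/eqP; rewrite -rnorm_eq0; apply/negPn/negP => xn0.
  have x0 : 0 < rnorm x by rewrite lt_neqAle eq_sym xn0 rnorm_ge0.
  have lx := supercyclic_limsup_norm0 ler01 powM kP nfd x.
  have [N /(_ N (leqnn N))] := limsup_norm_eq0 powM lx x0.
  by rewrite iterE ltxx.
by apply: nfd; exists 0%N, (fun=> 0) => x; exists (fun=> 0); rewrite big_ord0.
Qed.

End ScalarField.

(** * Completeness of the real and complex scalars, and specialisation to both fields *)

Lemma real_cauchy_complete (R : realType) (u : nat -> R) :
  (forall e : R, 0 < e -> exists N : nat, forall i j : nat,
     (N <= i)%N -> (N <= j)%N -> `|u i - u j| < e) ->
  exists l : R, forall e : R, 0 < e -> exists N : nat, forall j : nat,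
     (N <= j)%N -> `|u j - l| < e.
Proof.
move=> uP.
have /cauchy_cvgP ul : cauchy (u @ \oo).
  apply/cauchy_exP => e /uP[N NP]; exists (u N); exists N => // n /= Nn.
  by rewrite -ball_normE /=; exact: NP.
exists (lim (u @ \oo)) => e e0; move/cvgrPdist_lt : ul => /(_ _ e0)[N _ NP].
by exists N => j Nj; rewrite distrC; exact: NP.
Qed.

(** The modulus dominates both coordinates and is at most the sum of their absolute values, so
    convergence is coordinatewise. *)
Lemma complex_cauchy_complete (R : realType) (u : nat -> R[i]) :
  (forall e : R, 0 < e -> exists N : nat, forall i j : nat,
     (N <= i)%N -> (N <= j)%N -> complex.Re `|u i - u j| < e) ->
  exists l : R[i], forall e : R, 0 < e -> exists N : nat, forall j : nat,
     (N <= j)%N -> complex.Re `|u j - l| < e.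
Proof.
have norm_ge (z : R[i]) : `|complex.Re z| <= complex.Re `|z|
    /\ `|complex.Im z| <= complex.Re `|z|.
  rewrite normc_def /=; split; rewrite -sqrtr_sqr ler_sqrt ?addr_ge0 ?sqr_ge0//.
    by rewrite lerDl sqr_ge0.
  by rewrite lerDr sqr_ge0.
have norm_le (z : R[i]) : complex.Re `|z| <= `|complex.Re z| + `|complex.Im z|.
  rewrite normc_def /= -[leRHS]ger0_norm ?addr_ge0// -sqrtr_sqr.
  rewrite ler_sqrt ?sqr_ge0// sqrrD !real_normK ?num_real//.
  by rewrite lerD2r lerDl mulrn_wge0// mulr_ge0.
move=> uP.
have [e /uP[N NP]|a aP] := @real_cauchy_complete R (fun n => complex.Re (u n)).
  exists N => i j Ni Nj; apply: le_lt_trans (NP i j Ni Nj).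
  by rewrite -raddfB; case: (norm_ge (u i - u j)).
have [e /uP[N NP]|b bP] := @real_cauchy_complete R (fun n => complex.Im (u n)).
  exists N => i j Ni Nj; apply: le_lt_trans (NP i j Ni Nj).
  by rewrite -raddfB; case: (norm_ge (u i - u j)).
exists (a +i* b)%C => e e0; have e20 : 0 < e / 2 by rewrite divr_gt0.
have [Na NaP] := aP _ e20; have [Nb NbP] := bP _ e20.
exists (maxn Na Nb) => j; rewrite geq_max => /andP[/NaP ja /NbP jb].
apply: (le_lt_trans (norm_le _)); rewrite !raddfB /=; lra.
Qed.

Theorem theorem4 (R : realType) :
  (forall (X : completeNormedModType R) (T : {linear X -> X}),
     ~ finite_dimensional X -> bounded_operator idfun T ->
     (linear_isometry T -> ~ supercyclic T) /\
     (power_bounded idfun T -> supercyclic T ->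
      forall x : X, iter n T x @[n --> \oo] --> (0 : X)))
  /\
  (forall (X : completeNormedModType R[i]) (T : {linear X -> X}),
     ~ finite_dimensional X -> bounded_operator (@complex.Re R) T ->
     (linear_isometry T -> ~ supercyclic T) /\
     (power_bounded (@complex.Re R) T -> supercyclic T ->
      forall x : X, iter n T x @[n --> \oo] --> (0 : X))).
Proof.
split=> X T nfd _.
  pose iota : {rmorphism R -> R} := idfun.
  have iota_le (a b : R) : (iota a <= iota b) = (a <= b) by [].
  have iota_re (c : R) : 0 <= c -> iota (idfun c) = c by [].
  have compl := @real_cauchy_complete R.
  split; first exact: (isometry_not_supercyclic iota_le iota_re compl).
  move=> /(power_bounded_bound iota_le iota_re)[M [M0 powM]].
  exact: (power_bounded_supercyclic_cvg0 iota_le iota_re compl M0 powM).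
pose iota : {rmorphism R -> R[i]} := real_complex R.
have iota_le (a b : R) : (iota a <= iota b) = (a <= b) := lecR a b.
have iota_re (c : R[i]) : 0 <= c -> iota (complex.Re c) = c.
  by move=> c0; rewrite /iota /= RRe_real// ger0_real.
have compl := @complex_cauchy_complete R.
split; first exact: (isometry_not_supercyclic iota_le iota_re compl).
move=> /(power_bounded_bound iota_le iota_re)[M [M0 powM]].
exact: (power_bounded_supercyclic_cvg0 iota_le iota_re compl M0 powM).
Qed.
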